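(* Let $w$ be an infinite word over an alphabet $\Sigma$ with $|\Sigma|\ge2$ generated by a morphism $\phi$ with $\det A_\phi\ne\pm1$. Then $w$ does not satisfy the WELLDOC property.
   Context: $\Sigma=\{0,\dots,\sigma-1\}$. A morphism is nonerasing; $w$ is generated by $\phi$ if $\phi(a)=as$ with $s$ nonempty and $w=\lim_n\phi^n(a)$. $A_\phi$ is the $\sigma\times\sigma$ matrix with entry $|\phi(i)|_j$ in row $j$, column $i$. Parikh vector $V_u=(|u|_0,\dots,|u|_{\sigma-1})$; for a factor $u$ occurring at positions $a_0<a_1<\dots$, $X_u=\{V_{w[0,a_i)}\}$, $X_{u,m}$ its reduction mod $m$; WELLDOC means $X_{u,m}=(\mathbb{Z}/m\mathbb{Z})^\sigma$ for all $m\ge1$ and all factors $u$ of $w$. *)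

(* Defs.v *)
From HB Require Import structures.
From mathcomp Require Import all_boot all_order all_algebra.
From mathcomp Require Import classical_sets.

Set Implicit Arguments.
Unset Strict Implicit.
Unset Printing Implicit Defensive.

Import GRing.Theory.

Local Open Scope ring_scope.
Local Open Scope classical_set_scope.

(* The alphabet {0, ..., sigma - 1} is 'I_sigma.  A morphism of the free monoid
   on it is given by its values on letters; [morph phi] is its extension to
   words.  An infinite word is a function [nat -> 'I_sigma]. *)

Definition morph sigma (phi : 'I_sigma -> seq 'I_sigma) (u : seq 'I_sigma) :
  seq 'I_sigma := flatten (map phi u).

Definition nonerasing sigma (phi : 'I_sigma -> seq 'I_sigma) : Prop :=
  forall i, phi i <> [::].

(* w[i, i + n) *)
Definition window sigma (w : nat -> 'I_sigma) (i n : nat) : seq 'I_sigma :=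
  mkseq (fun k => w (i + k)%N) n.

(* Convergence of a sequence of finite words to an infinite word: any given
   prefix of w is a prefix of all but finitely many terms of the sequence. *)
Definition word_lim sigma (u : nat -> seq 'I_sigma) (w : nat -> 'I_sigma) :
  Prop :=
  forall k, exists N, forall n, (N <= n)%N -> prefix (window w 0 k) (u n).

Definition generated_by sigma (phi : 'I_sigma -> seq 'I_sigma)
  (w : nat -> 'I_sigma) : Prop :=
  exists a s, [/\ phi a = a :: s, s <> [::] &
                  word_lim (fun n => iter n (morph phi) [:: a]) w].

Definition incidence_mx sigma (phi : 'I_sigma -> seq 'I_sigma) :
  'M[int]_sigma := \matrix_(j, i) (count_mem j (phi i))%:Z.

Definition parikh sigma (u : seq 'I_sigma) : 'rV[nat]_sigma :=
  \row_j count_mem j u.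

Definition occurs_at sigma (w : nat -> 'I_sigma) (u : seq 'I_sigma) (i : nat) :
  Prop := window w i (size u) = u.

Definition factor sigma (w : nat -> 'I_sigma) (u : seq 'I_sigma) : Prop :=
  exists i, occurs_at w u i.

Definition X sigma (w : nat -> 'I_sigma) (u : seq 'I_sigma) :
  set 'rV[nat]_sigma :=
  [set parikh (window w 0 i) | i in [set i | occurs_at w u i]].

(* The modulus is m.+1, and Z/(m.+1)Z is 'I_m.+1 with projection inZp; unlike
   'Z_m, this is also correct for the modulus 1. *)
Definition Xmod sigma (w : nat -> 'I_sigma) (u : seq 'I_sigma) (m : nat) :
  set 'rV['I_m.+1]_sigma :=
  [set map_mx (@inZp m) v | v in X w u].

Arguments Xmod {sigma} w u m _.

Definition WELLDOC sigma (w : nat -> 'I_sigma) : Prop :=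
  forall (m : nat) (u : seq 'I_sigma), factor w u ->
    Xmod w u m = [set: 'rV['I_m.+1]_sigma].

(* Main.v *)
(* Write A for the incidence matrix and suppose w is WELLDOC, so that no nonzero
   integer functional r keeps r.V bounded along the prefixes of w. As w is a
   fixed point of phi, it is cut into the blocks phi (w k), and r.V is (rA).V
   of a shorter prefix at each cut. If det A = 0 then some r with rA = 0 is
   bounded.
   Otherwise let d = det A and let r be a row of adj A not divisible by d:
   then r.V = 0 mod d at every cut. By WELLDOC, arbitrarily long prefixes of w
   recur at positions where r.V is not 0 mod d, and by compactness w has a
   second factorization into blocks of phi, without any common cut. Merging
   the two, one follows the overlaps between a cut and the next cut of the
   other factorization, which take finitely many values. If every recurrent
   overlap p has only one continuation, w is eventually periodic, and then
   some functional is bounded. If p returns after two different letters b and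
   c, then phi(b..)p = p phi(..) and phi(c..)p = p phi(..), and the graph lemma
   of the theory of codes expresses all the phi(i) over fewer words than there
   are letters, whence det A = 0. *)
Require Import Defs.
From mathcomp Require Import all_boot all_order all_algebra.
From mathcomp Require Import boolp classical_sets zify.

Set Implicit Arguments.
Unset Strict Implicit.
Unset Printing Implicit Defensive.

Import Order.TTheory GRing.Theory Num.Theory.

Local Open Scope ring_scope.

(** * Recoding by blocks and the defect lemma for two equations *)

Section Recoding.
Variables (Y : eqType) (y : Y).

(* [recode u] is the number of leading occurrences of y in u, followed by the
   cutting of the rest of u into blocks z y^k with z different from y. *)
Definition recode (u : seq Y) : nat * seq (Y * nat) :=
  foldr (fun z kv => if z == y then (kv.1.+1, kv.2)
                     else (0%N, (z, kv.1) :: kv.2))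
    (0%N, [::]) u.

Definition unblock (zk : Y * nat) : seq Y := zk.1 :: nseq zk.2 y.

Lemma recodeK u :
  nseq (recode u).1 y ++ flatten (map unblock (recode u).2) = u.
Proof.
elim: u => //= z u IH; case: eqP => [->|_] /=; first by rewrite IH.
by rewrite IH.
Qed.

(** Leading [y]s of [v] would be absorbed by the last block of [u]; without them cutting is
    compatible with concatenation. *)
Lemma recode_cat u v : (recode v).1 = 0%N ->
  recode (u ++ v) = ((recode u).1, (recode u).2 ++ (recode v).2).
Proof.
move=> v0; elim: u => /= [|z u ->]; first by rewrite -v0; case: (recode v).
by case: eqP.
Qed.

Lemma recode_head u : ohead u != Some y -> (recode u).1 = 0%N.
Proof. by case: u => //= z u; case: (z =P y) => // ->; rewrite eqxx. Qed.

Lemma size_recode u : size (recode u).2 = count (predC1 y) u.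
Proof. by elim: u => //= z u IH; case: eqP => /=; rewrite IH. Qed.

Lemma recode_flatten (T : Type) (tau : T -> seq Y) (s : seq T) :
  (forall x, ohead (tau x) != Some y) ->
  recode (flatten (map tau s)) =
    (0%N, flatten (map (fun x => (recode (tau x)).2) s)).
Proof.
move=> hd; elim: s => //= x s IH; rewrite recode_cat IH //=.
by rewrite recode_head.
Qed.

End Recoding.

Lemma sum_flatten_map (R : nmodType) (S T : Type) (rho : S -> seq T)
    (g : T -> R) (u : seq S) :
  \sum_(x <- flatten (map rho u)) g x = \sum_(z <- u) \sum_(x <- rho z) g x.
Proof. by rewrite big_flatten big_map. Qed.

Lemma sum_count_mem (T : eqType) (g : T -> int) (L u : seq T) :
  uniq L -> {subset u <= L} ->
  \sum_(x <- u) g x = \sum_(x <- L) (count_mem x u)%:Z * g x.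
Proof.
move=> Lu; elim: u => [_|z u IH sub].
  by rewrite big_nil big1 // => x _; rewrite mul0r.
rewrite big_cons IH; last by move=> x xu; apply: sub; rewrite inE xu orbT.
transitivity (\sum_(x <- L) ((z == x)%:Z * g x + (count_mem x u)%:Z * g x)).
  rewrite big_split /=; congr (_ + _).
  rewrite (bigD1_seq z) ?sub ?mem_head //= eqxx mul1r big1 ?addr0 // => x.
  by rewrite eq_sym => /negbTE ->; rewrite mul0r.
by apply: eq_bigr => x _; rewrite /= PoszD mulrDl.
Qed.

Lemma sum_count_enum (T : finType) (g : T -> int) (u : seq T) :
  \sum_(x <- u) g x = \sum_x (count_mem x u)%:Z * g x.
Proof.
rewrite (@sum_count_mem _ _ (enum T)) ?enum_uniq //; first by rewrite big_enum.
by move=> x _; rewrite mem_enum.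
Qed.

Lemma sum_eq_count (T : eqType) (u : seq T) i :
  \sum_(x <- u) (x == i)%:Z = (count_mem i u)%:Z.
Proof.
elim: u => [|y u IH]; first by rewrite big_nil.
by rewrite big_cons IH.
Qed.

(* If every letter of the words tau x begins one of them, the two equations
   identify the first letters of tau None, tau (Some b) and tau (Some c), so
   that fewer than sigma letters occur. Otherwise some letter y begins no
   tau x, and recoding by the blocks z y^k shortens the words. *)
Lemma defect sigma (b c : 'I_sigma) (n : nat) :
  forall (Y : eqType) (tau : option 'I_sigma -> seq Y)
    (s1 t1 s2 t2 : seq (option 'I_sigma)),
  b != c -> (forall x, tau x != [::]) ->
  (\sum_x size (tau x) <= n)%N ->
  flatten (map tau (Some b :: s1)) = flatten (map tau (None :: t1)) ->
  flatten (map tau (Some c :: s2)) = flatten (map tau (None :: t2)) ->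
  exists2 v : 'rV[int]_sigma, v != 0 &
    forall g : Y -> int, \sum_i v 0 i * (\sum_(x <- tau (Some i)) g x) = 0.
Proof.
elim: n => [|n IH] Y tau s1 t1 s2 t2 bc tau0 hn e1 e2.
  have := tau0 None; rewrite -size_eq0 -leqn0.
  by rewrite (leq_trans _ hn) // (bigD1 None) //= leq_addr.
have [y0 _] : exists y0, y0 \in tau None.
  by case: (tau None) (tau0 None) => // z u _; exists z; rewrite mem_head.
pose h x := head y0 (tau x).
have tauE x : tau x = h x :: behead (tau x).
  by rewrite /h; case: (tau x) (tau0 x).
have hb : h (Some b) = h None.
  by move: e1; rewrite /= (tauE (Some b)) (tauE None) /= => -[].
have hc : h (Some c) = h None.
  by move: e2; rewrite /= (tauE (Some c)) (tauE None) /= => -[].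
have [heads|[x [y [yx yh]]]] :
    (forall x z, z \in tau x -> exists x', z = h x') \/
    exists x y, y \in tau x /\ forall x', y != h x'.
  case: (pselect (exists x y, y \in tau x /\ forall x', y != h x')) => [|nex].
    by right.
  left.
  move=> x z zx; apply: contrapT => nz; apply: nex; exists x, z; split=> // x'.
  by apply/eqP => E; apply: nz; exists x'.
- pose B : 'M[int]_sigma :=
    \matrix_(i, k) (count_mem (h (Some k)) (tau (Some i)))%:Z.
  (* Columns [b] and [c] of [B] count the same letter, since both heads equal [h None]. *)
  have /eqP/det0P [v v0 vB] : \det B = 0.
    rewrite -det_tr; apply: (determinant_alternate bc) => i.
    by rewrite !mxE hb hc.
  exists v => // g.
  (* Different [k] may share a head, as [b] and [c] do; each letter must be counted once. *)
  pose L := undup [seq h (Some k) | k <- enum 'I_sigma].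
  have LP i : {subset tau (Some i) <= L}.
    move=> z /heads [x ->]; rewrite mem_undup.
    case: x => [k|]; first by apply: map_f; rewrite mem_enum.
    by rewrite -hb; apply: map_f; rewrite mem_enum.
  under eq_bigr => i _ do
    rewrite (sum_count_mem g (undup_uniq _) (@LP i)) mulr_sumr.
  rewrite exchange_big big_seq big1 // => z.
  rewrite mem_undup => /mapP [k _ ->].
  transitivity ((v *m B) 0 k * g (h (Some k))); last by rewrite vB mxE mul0r.
  rewrite mxE mulr_suml; apply: eq_bigr => i _.
  by rewrite mxE mulrA.
- have hd x' : ohead (tau x') != Some y.
    by rewrite tauE /=; apply: contra (yh x') => /eqP [->].
  pose tau' x := (recode y (tau x)).2.
  have tauK x' : tau x' = flatten (map (unblock y) (tau' x')).
    by rewrite -{1}(recodeK y (tau x')) recode_head.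
  have eqK s t : flatten (map tau s) = flatten (map tau t) ->
      flatten (map tau' s) = flatten (map tau' t).
    by move=> /(congr1 (recode y)); rewrite !recode_flatten // => -[].
  have szle x' : (size (tau' x') <= size (tau x'))%N.
    by rewrite size_recode count_size.
  have [||v v0 vP] := IH _ tau' s1 t1 s2 t2 bc _ _ (eqK _ _ e1) (eqK _ _ e2).
  - move=> x'; rewrite -size_eq0 size_recode -lt0n -has_count.
    by rewrite tauE /= eq_sym yh.
  (* The total size drops because [tau x] contains [y], and only letters other than [y] begin
     blocks. *)
  - rewrite -ltnS; apply: leq_trans hn.
    rewrite (bigD1 x) // [X in (_ < X)%N](bigD1 x) //= -addSn.
    rewrite leq_add ?leq_sum //.
    rewrite size_recode -(count_predC (predC1 y) (tau x)) -addn1 leq_add2l.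
    by rewrite -has_count; apply/hasP; exists y => //=; rewrite eqxx.
  (* Giving a block the total weight of its letters turns the relation for [tau'] into the one for
     [tau]. *)
  exists v => // g; apply: etrans (vP (fun z => \sum_(x <- unblock y z) g x)).
  by under eq_bigr => i _ do rewrite tauK sum_flatten_map.
Qed.

(** * Overlap equations and the incidence matrix *)

Section Morphism.
Variables (sigma : nat) (phi : 'I_sigma -> seq 'I_sigma).

Lemma mul_incidence_mxE (r : 'rV[int]_sigma) i :
  (r *m incidence_mx phi) 0 i = \sum_(x <- phi i) r 0 x.
Proof.
rewrite mxE [RHS]sum_count_enum.
by apply: eq_bigr => j _; rewrite mxE mulrC.
Qed.

(** With [p] as the extra word [tau None], these are the equations of [defect]; its relation, tested
    on indicator weights of letters, is a kernel vector of the transposed matrix. *)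
Lemma det_incidence_overlap (p : seq 'I_sigma) b c s1 t1 s2 t2 :
  nonerasing phi -> p != [::] -> b != c ->
  morph phi (b :: s1) ++ p = p ++ morph phi t1 ->
  morph phi (c :: s2) ++ p = p ++ morph phi t2 ->
  \det (incidence_mx phi) = 0.
Proof.
move=> ne p0 bc e1 e2.
pose tau x := if x is Some i then phi i else p.
have tauE s : flatten (map tau (map Some s)) = morph phi s by rewrite -map_comp.
have [|||x v0 vP] := @defect sigma b c _ _ tau (map Some s1 ++ [:: None])
  (map Some t1) (map Some s2 ++ [:: None]) (map Some t2) bc _ (leqnn _).
- by case=> [i|//]; apply/eqP/ne.
- by rewrite /= map_cat flatten_cat !tauE /= cats0 catA.
- by rewrite /= map_cat flatten_cat !tauE /= cats0 catA.
apply/eqP; rewrite -det_tr; apply/det0P; exists x => //.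
apply/rowP => j; rewrite [LHS]mxE [RHS]mxE.
apply: etrans (vP (fun y => (y == j)%:Z)).
by apply: eq_bigr => i _; rewrite !mxE sum_eq_count.
Qed.

End Morphism.

(** * Windows of an infinite word *)

Section Window.
Variables (sigma : nat) (w : nat -> 'I_sigma).

Lemma size_window i n : size (window w i n) = n.
Proof. exact: size_mkseq. Qed.

Lemma windowD i m n : window w i (m + n) = window w i m ++ window w (i + m) n.
Proof.
rewrite /window /mkseq iotaD map_cat; congr (_ ++ _).
have -> : iota (0 + m) n = map (addn m) (iota 0 n) by rewrite -iotaDl addnC.
by rewrite -map_comp; apply: eq_map => k /=; rewrite addnA.
Qed.

Lemma window_glue i j k : (i <= j)%N -> (j <= k)%N ->
  window w i (j - i) ++ window w j (k - j) = window w i (k - i).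
Proof.
move=> ij jk; rewrite (_ : (k - i = (j - i) + (k - j))%N); last by lia.
by rewrite windowD subnKC.
Qed.

Lemma window1 i : window w i 1 = [:: w i].
Proof. by rewrite /window /mkseq /= addn0. Qed.

Lemma drop_window i m n : drop m (window w i n) = window w (i + m) (n - m).
Proof.
case: (leqP m n) => [mn|/ltnW nm]; last first.
  move: (nm); rewrite -subn_eq0 => /eqP ->.
  by rewrite drop_oversize ?size_window.
by rewrite -{1}(subnKC mn) windowD drop_size_cat ?size_window.
Qed.

Lemma take_window i m n : take m (window w i n) = window w i (minn m n).
Proof.
case: (leqP m n) => [mn|/ltnW nm].
  by rewrite -{1}(subnKC mn) windowD take_size_cat ?size_window.
by rewrite take_oversize ?size_window.
Qed.

Lemma window_shift n L a m : window w n L = window w 0 L -> (a + m <= L)%N ->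
  window w (n + a) m = window w a m.
Proof.
move=> e le; have /(congr1 (fun u => take m (drop a u))) := e.
by rewrite !drop_window !take_window add0n (minn_idPl _) //; lia.
Qed.

End Window.

(** * Factorizations into blocks of the morphism, and their overlaps *)

Section Factorization.
Variables (sigma : nat) (phi : 'I_sigma -> seq 'I_sigma) (w : nat -> 'I_sigma).

Lemma morph_cat u v : morph phi (u ++ v) = morph phi u ++ morph phi v.
Proof. by rewrite /morph map_cat flatten_cat. Qed.

Lemma morph1 b : morph phi [:: b] = phi b.
Proof. by rewrite /morph /= cats0. Qed.

(* w[c 0, oo) is the concatenation of the blocks phi (z n), cut at the
   positions c n. *)
Definition factorization (z : nat -> 'I_sigma) (c : nat -> nat) : Prop :=
  forall n, c n.+1 = (c n + size (phi (z n)))%N /\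
            window w (c n) (size (phi (z n))) = phi (z n).

Section OneFactorization.
Variables (z : nat -> 'I_sigma) (c : nat -> nat).
Hypothesis zc : factorization z c.

Lemma cutD i n : c (i + n) = (c i + size (morph phi (window z i n)))%N.
Proof.
elim: n => [|n IH]; first by rewrite !addn0.
rewrite addnS (zc _).1 IH -[in RHS]addn1 windowD morph_cat size_cat window1.
by rewrite morph1 addnA.
Qed.

Lemma window_cut i n :
  window w (c i) (c (i + n) - c i) = morph phi (window z i n).
Proof.
elim: n => [|n IH]; first by rewrite addn0 subnn.
rewrite addnS (zc _).1 -[in RHS]addn1 windowD morph_cat window1 morph1.
have le : (c i <= c (i + n))%N by rewrite cutD leq_addr.
by rewrite -addnBAC // windowD IH subnKC // (zc _).2.
Qed.

Lemma cut_le i j : (i <= j)%N -> (c i <= c j)%N.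
Proof. by move=> /subnKC <-; rewrite cutD leq_addr. Qed.

Lemma cut_lt i j : nonerasing phi -> (i < j)%N -> (c i < c j)%N.
Proof.
move=> ne ij; apply: leq_trans (cut_le ij); rewrite (zc _).1 -addn1 leq_add2l.
by rewrite lt0n size_eq0; apply/eqP/ne.
Qed.

(* The overlap w[c i, q) with the next cut q of another factorization
   determines, together with the letter z i, what follows. *)
Lemma overlap_step i q (p := window w (c i) (q - c i)) :
  (c i < q)%N ->
  [/\ window w (c i) (minn (c i.+1) q - c i) = take (size p) (phi (z i)),
      (minn (c i.+1) q = c i + minn (size (phi (z i))) (size p))%N,
      (c i.+1 < q)%N ->
        window w (c i.+1) (q - c i.+1) = drop (size (phi (z i))) p &
      (q <= c i.+1)%N -> window w q (c i.+1 - q) = drop (size p) (phi (z i))].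
Proof.
move=> iq; have [e1 e2] := zc i.
have sp : size p = (q - c i)%N by rewrite size_window.
split.
- by rewrite -[in RHS]e2 take_window sp e1; congr window; lia.
- by rewrite sp e1; lia.
- by move=> _; rewrite /p drop_window e1; congr window; lia.
- by move=> _; rewrite -[in RHS]e2 drop_window sp e1; congr window; lia.
Qed.

End OneFactorization.

(** The factor from [c i] to [c' j'] is read in two ways: blocks up to [c i'] and then [p], or [p]
    and then blocks from [c' j]. *)
Lemma overlap_return z c z' c' i i' j j' (p := window w (c i) (c' j - c i)) :
  nonerasing phi -> factorization z c -> factorization z' c' ->
  (i <= i')%N -> (j <= j')%N -> (i + j < i' + j')%N ->
  (c i < c' j)%N -> (c i' < c' j')%N ->
  window w (c i') (c' j' - c i') = p ->
  exists s t, morph phi (z i :: s) ++ p = p ++ morph phi t.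
Proof.
move=> ne zc zc' ii jj lt cij cij' ep.
have sz : (c' j' - c i' = c' j - c i)%N.
  by rewrite -(size_window w (c i') (c' j' - c i')) ep size_window.
have lti : (i < i')%N.
  (* If only the second cut had moved, the overlap would have grown. *)
  rewrite ltn_neqAle ii andbT; apply/eqP => E; subst i'.
  have /(cut_lt zc' ne) : (j < j')%N by lia.
  by move: sz cij cij'; lia.
exists (window z i.+1 (i' - i.+1)), (window z' j (j' - j)).
have -> : z i :: window z i.+1 (i' - i.+1) = window z i (i' - i).
  rewrite (_ : (i' - i = 1 + (i' - i.+1))%N); last by lia.
  by rewrite windowD window1 addn1.
rewrite -(window_cut zc) -(window_cut zc') (subnKC ii) (subnKC jj).
rewrite -{1}ep /p.
by rewrite !window_glue ?(ltnW cij) ?(ltnW cij') ?(cut_le zc) ?(cut_le zc').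
Qed.

End Factorization.

(** * Compactness and recurrence over finite types *)

(** If each [x] failed at some [N x], all would fail at the maximum of these. *)
Lemma uniform_bound (T : finType) (P : nat -> T -> Prop) :
  (forall n x, P n.+1 x -> P n x) ->
  (forall n, exists x, P n x) -> exists x, forall n, P n x.
Proof.
move=> mono ex; apply: contrapT => /forallNP none.
have : forall x, exists n, ~ P n x by move=> x; apply/existsNP/none.
move=> /fin_all_exists [N HN].
have [x Px] := ex (\max_x N x); apply: (HN x).
have : (N x <= \max_x N x)%N by exact: leq_bigmax.
move: Px; elim: (\max_x N x) => [|n IH] Pn; first by rewrite leqn0 => /eqP ->.
by rewrite leq_eqVlt => /predU1P [->//|/IH]; apply; apply: mono.
Qed.

(** Each state visited only finitely often has a last visit; [T] lies beyond all of them. *)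
Lemma finite_recurrence (S : finType) (st : nat -> S) :
  exists T, forall t, (T <= t)%N ->
    forall t', exists2 t'', (t' <= t'')%N & st t'' = st t.
Proof.
have : forall s, exists T, (exists2 t, (T <= t)%N & st t = s) ->
    forall t', exists2 t'', (t' <= t'')%N & st t'' = s.
  move=> s; apply: contrapT => /forallNP H.
  by have /not_implyP [_ []] := H 0%N => T; have /not_implyP [] := H T.
move=> /fin_all_exists [T HT]; exists (\max_s T s) => t le.
apply: HT; exists t => //; apply: leq_trans le; exact: leq_bigmax.
Qed.

(** Once every state recurs, a later common return shows that the state determines the letter; the
    run is then deterministic, and repeating one state makes it periodic. *)
Lemma deterministic_recurrence (S : finType) (L : Type) (st : nat -> S)
    (l : nat -> L) (F : S -> L -> S) :
  (forall t, st t.+1 = F (st t) (l t)) ->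
  (forall t1 t2 t3, (t1 < t3)%N -> (t2 < t3)%N ->
     st t1 = st t3 -> st t2 = st t3 -> l t1 = l t2) ->
  exists t1 t2, (t1 < t2)%N /\
    forall k, st (t1 + k)%N = st (t2 + k)%N /\ l (t1 + k)%N = l (t2 + k)%N.
Proof.
move=> stE det; have [T HT] := finite_recurrence st.
have [T' lt eqT] := HT T (leqnn T) T.+1.
have lE t t' : (T <= t)%N -> st t = st t' -> l t = l t'.
  move=> le e; have [t'' lt'' e''] := HT t le (maxn t t').+1.
  by apply: (det _ _ t''); lia || congruence.
exists T, T'; split=> // k.
suff e : st (T + k)%N = st (T' + k)%N by split=> //; apply: lE e; lia.
elim: k => [|k IH]; first by rewrite !addn0.
rewrite !addnS !stE IH; congr F; apply: lE IH; lia.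
Qed.

(** * Merging two factorizations without common cut *)

Section TwoFactorizations.
Variables (sigma : nat) (phi : 'I_sigma -> seq 'I_sigma) (w : nat -> 'I_sigma).
Variables (z1 z2 : nat -> 'I_sigma) (c1 c2 : nat -> nat).
Hypothesis ne : nonerasing phi.
Hypotheses (zc1 : factorization phi w z1 c1) (zc2 : factorization phi w z2 c2).
Hypothesis disjoint : forall i j, c1 i <> c2 j.

Definition first_lags (ij : nat * nat) := (c1 ij.1 < c2 ij.2)%N.

Definition next_letter ij := if first_lags ij then z1 ij.1 else z2 ij.2.

(* Merging the two sequences of cuts: the lagging counter advances. *)
Definition merge_step ij :=
  if first_lags ij then (ij.1.+1, ij.2) else (ij.1, ij.2.+1).

Definition merge t := iter t merge_step (0, 0)%N.

Definition low_cut (ij : nat * nat) := minn (c1 ij.1) (c2 ij.2).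

Definition overlap (ij : nat * nat) :=
  window w (low_cut ij) (maxn (c1 ij.1) (c2 ij.2) - low_cut ij).

Lemma overlap_true ij : first_lags ij ->
  overlap ij = window w (c1 ij.1) (c2 ij.2 - c1 ij.1).
Proof.
rewrite /first_lags /overlap /low_cut => lt.
by rewrite (minn_idPl (ltnW lt)) (maxn_idPr (ltnW lt)).
Qed.

Lemma first_lagsN ij : ~~ first_lags ij -> (c2 ij.2 < c1 ij.1)%N.
Proof.
rewrite /first_lags -leqNgt leq_eqVlt => /predU1P [E|//].
by case: (@disjoint ij.1 ij.2).
Qed.

Lemma overlap_false ij : ~~ first_lags ij ->
  overlap ij = window w (c2 ij.2) (c1 ij.1 - c2 ij.2).
Proof.
move=> /first_lagsN lt; rewrite /overlap /low_cut.
by rewrite (minn_idPr (ltnW lt)) (maxn_idPl (ltnW lt)).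
Qed.

(** The merge is thus a finite transducer: lag and overlap evolve by the letter alone. Disjointness
    of the cuts rules out a tie. *)
Lemma merge_stepE ij (l := next_letter ij) (p := overlap ij) :
  [/\ first_lags (merge_step ij) =
        (if size (phi l) < size p then first_lags ij else ~~ first_lags ij)%N,
      overlap (merge_step ij) =
        (if size (phi l) < size p then drop (size (phi l)) p
         else drop (size p) (phi l))%N,
      low_cut (merge_step ij) = (low_cut ij + minn (size (phi l)) (size p))%N &
      window w (low_cut ij) (minn (size (phi l)) (size p)) =
        take (size p) (phi l)].
Proof.
rewrite {}/l {}/p /next_letter; case: (boolP (first_lags ij)) => lag.
- have [W Q D1 D2] := overlap_step zc1 lag.
  have e1 := (zc1 ij.1).1; have dj := @disjoint ij.1.+1 ij.2.
  have pos : low_cut ij = c1 ij.1 by rewrite /low_cut (minn_idPl (ltnW lag)).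
  rewrite (overlap_true lag) pos size_window.
  rewrite (_ : merge_step ij = (ij.1.+1, ij.2)); last first.
    by rewrite /merge_step lag.
  have -> : (size (phi (z1 ij.1)) < c2 ij.2 - c1 ij.1)%N =
      (c1 ij.1.+1 < c2 ij.2)%N.
    by rewrite e1; rewrite /first_lags in lag; lia.
  split.
  + by rewrite /first_lags /=; case: ifP.
  + case: ifP => lag'; first by rewrite overlap_true // D1.
    rewrite overlap_false /first_lags /= ?lag' //.
    by rewrite D2 ?size_window // leqNgt lag'.
  + by rewrite -(size_window w (c1 ij.1) (c2 ij.2 - _)) -Q.
  + by rewrite -(size_window w (c1 ij.1) (c2 ij.2 - _)) -W Q addKn.
- have lt := first_lagsN lag.
  have [W Q D1 D2] := overlap_step zc2 lt.
  have e1 := (zc2 ij.2).1; have dj := @disjoint ij.1 ij.2.+1.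
  have pos : low_cut ij = c2 ij.2 by rewrite /low_cut (minn_idPr (ltnW lt)).
  rewrite (overlap_false lag) pos size_window.
  rewrite (_ : merge_step ij = (ij.1, ij.2.+1)); last first.
    by rewrite /merge_step (negbTE lag).
  have -> : (size (phi (z2 ij.2)) < c1 ij.1 - c2 ij.2)%N =
      (c2 ij.2.+1 < c1 ij.1)%N by rewrite e1; lia.
  have lag'E : first_lags (ij.1, ij.2.+1) = ~~ (c2 ij.2.+1 < c1 ij.1)%N.
    by rewrite /first_lags /=; lia.
  split.
  + by rewrite lag'E; case: ifP.
  + case: ifP => lag'; first by rewrite overlap_false ?lag'E ?lag' // D1.
    rewrite overlap_true ?lag'E ?lag' //.
    by rewrite D2 ?size_window // leqNgt lag'.
  + by rewrite -(size_window w (c2 ij.2) (c1 ij.1 - _)) -Q /low_cut minnC.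
  + by rewrite -(size_window w (c2 ij.2) (c1 ij.1 - _)) -W Q addKn.
Qed.

Lemma overlap_neq0 ij : overlap ij != [::].
Proof.
rewrite -size_eq0 size_window /low_cut; have := @disjoint ij.1 ij.2; lia.
Qed.

Lemma merge_le t k : ((merge t).1 <= (merge (t + k)).1)%N /\
  ((merge t).2 <= (merge (t + k)).2)%N.
Proof.
elim: k => [|k [IH1 IH2]]; first by rewrite addn0.
rewrite addnS /merge iterS -/(merge _) /merge_step.
by case: ifP => _ /=; rewrite ?IH1 ?IH2 ?leqW.
Qed.

Lemma merge_sum t : ((merge t).1 + (merge t).2 = t)%N.
Proof.
elim: t => // t IH; rewrite /merge iterS -/(merge _) /merge_step.
by case: ifP => _ /=; rewrite ?addnS ?addSn IH.
Qed.

Lemma merge_return t t' (p := overlap (merge t)) : (t < t')%N ->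
  first_lags (merge t) = first_lags (merge t') -> overlap (merge t') = p ->
  exists s u, morph phi (next_letter (merge t) :: s) ++ p = p ++ morph phi u.
Proof.
move=> lt eqL; have [le1 le2] := merge_le t (t' - t).
rewrite subnKC ?(ltnW lt) // in le1 le2.
rewrite /p /next_letter; case: (boolP (first_lags (merge t))) => lag eqO.
- have lag' : first_lags (merge t') by rewrite -eqL.
  rewrite (overlap_true lag') (overlap_true lag) in eqO.
  rewrite (overlap_true lag).
  apply: (overlap_return ne zc1 zc2 le1 le2) eqO => //.
  by rewrite !merge_sum.
- have lag' : ~~ first_lags (merge t') by rewrite -eqL.
  rewrite (overlap_false lag') (overlap_false lag) in eqO.
  rewrite (overlap_false lag).
  apply: (overlap_return ne zc2 zc1 le2 le1) eqO; try exact: first_lagsN.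
  by rewrite 2!(addnC _.2) !merge_sum.
Qed.

(** Each new overlap is a suffix of the previous one or of a block. *)
Let bound := maxn (size (overlap (0, 0)%N)) (\max_b size (phi b)).

Lemma overlap_bound t : (size (overlap (merge t)) <= bound)%N.
Proof.
elim: t => [|t IH]; first by rewrite leq_maxl.
rewrite /merge iterS -/(merge t); have [_ -> _ _] := merge_stepE (merge t).
case: ifP => _; rewrite size_drop; apply: leq_trans (leq_subr _ _) _ => //.
apply: leq_trans (leq_maxr _ _).
exact: (leq_bigmax (F := fun b => size (phi b))).
Qed.

Lemma periodic_or_singular : \det (incidence_mx phi) <> 0 ->
  exists N D, (0 < D)%N /\ forall n, (N <= n)%N -> w (n + D) = w n.
Proof.
move=> det0.
(* Bounded sequences make the state type finite; by [overlap_bound] the default of [insub_bseq]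
   never occurs here. *)
pose st t := (first_lags (merge t), insub_bseq bound (overlap (merge t))).
pose l t := next_letter (merge t).
pose F (s : bool * bound.-bseq 'I_sigma) (b : 'I_sigma) :=
  if (size (phi b) < size s.2)%N
  then (s.1, insub_bseq bound (drop (size (phi b)) s.2))
  else (~~ s.1, insub_bseq bound (drop (size s.2) (phi b))).
have ovE t : (st t).2 = overlap (merge t) :> seq _.
  by rewrite /= /insub_bseq insubdK //; exact: overlap_bound.
have stE t : st t.+1 = F (st t) (l t).
  have [E1 E2 _ _] := merge_stepE (merge t).
  by rewrite /F ovE /st /merge iterS -/(merge t) E1 E2 /= -/(l t); case: ifP.
have det t1 t2 t3 : (t1 < t3)%N -> (t2 < t3)%N ->
    st t1 = st t3 -> st t2 = st t3 -> l t1 = l t2.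
  move=> lt1 lt2 e1 e2; apply/eqP/negPn/negP => nl; apply: det0.
  have ret t : (t < t3)%N -> st t = st t3 -> exists s u,
      morph phi (l t :: s) ++ overlap (merge t3) =
      overlap (merge t3) ++ morph phi u.
    move=> lt e; rewrite -ovE -e ovE.
    apply: (merge_return lt); first by case: e.
    by rewrite -!ovE e.
  have [s1 [u1 r1]] := ret _ lt1 e1; have [s2 [u2 r2]] := ret _ lt2 e2.
  exact: (det_incidence_overlap ne (overlap_neq0 _) nl r1 r2).
have [t1 [t2 [lt per]]] := deterministic_recurrence stE det.
pose pos t := low_cut (merge t).
pose d t := minn (size (phi (l t))) (size (overlap (merge t))).
have posS t : pos t.+1 = (pos t + d t)%N.
  rewrite /pos /merge iterS -/(merge t).
  by have [_ _ -> _] := merge_stepE (merge t).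
have d0 t : (0 < d t)%N.
  rewrite leq_min !lt0n !size_eq0 overlap_neq0 andbT; exact/eqP/ne.
have posD t k : (pos t + k <= pos (t + k))%N.
  elim: k => [|k IH]; first by rewrite !addn0.
  by rewrite !addnS posS; have := d0 (t + k)%N; lia.
have dE k : d (t1 + k)%N = d (t2 + k)%N.
  by have [e1 e2] := per k; rewrite /d -!ovE e1 e2.
(* The text passed in one step depends only on state and letter, so it repeats with them. *)
have blockE t : window w (pos t) (d t) = take (size (st t).2) (phi (l t)).
  by rewrite ovE; have [_ _ _] := merge_stepE (merge t).
have posE k : (pos (t2 + k) - pos t2 = pos (t1 + k) - pos t1)%N.
  elim: k => [|k IH]; first by rewrite !addn0 !subnn.
  rewrite !addnS !posS dE; have := posD t1 k; have := posD t2 k; lia.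
have wE k : window w (pos t2) (pos (t2 + k)%N - pos t2) =
    window w (pos t1) (pos (t1 + k)%N - pos t1).
  elim: k => [|k IH]; first by rewrite !addn0 !subnn.
  have glue t : window w (pos t) (pos (t + k.+1)%N - pos t) =
      window w (pos t) (pos (t + k)%N - pos t) ++
      window w (pos (t + k)%N) (d (t + k)%N).
    rewrite addnS posS -[d _](addKn (pos (t + k)%N)) window_glue ?leq_addr //.
      by rewrite addKn.
    by have := posD t k; lia.
  by have [e1 e2] := per k; rewrite !glue IH !blockE e1 e2.
have lt12 : (pos t1 < pos t2)%N.
  by have := posD t1 (t2 - t1)%N; rewrite subnKC; lia.
exists (pos t1), (pos t2 - pos t1)%N; split; first by rewrite subn_gt0.
move=> n len; pose k := (n - pos t1).+1.
have lk : (n - pos t1 < pos (t1 + k)%N - pos t1)%N.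
  by have := posD t1 k; rewrite /k; lia.
have := congr1 (fun u => nth (w 0%N) u (n - pos t1)) (wE k).
rewrite posE /window !nth_mkseq // => e.
rewrite (_ : n + (pos t2 - pos t1) = pos t2 + (n - pos t1))%N; last by lia.
by rewrite e subnKC.
Qed.

End TwoFactorizations.

(** * A second factorization by compactness *)

Section SecondFactorization.
Variables (sigma : nat) (phi : 'I_sigma -> seq 'I_sigma) (w : nat -> 'I_sigma).
Variables (z : nat -> 'I_sigma) (c : nat -> nat).
Hypothesis ne : nonerasing phi.
Hypothesis zc : factorization phi w z c.
Hypothesis c0 : c 0 = 0%N.

Lemma between_cuts n : exists k, (c k <= n < c k.+1)%N.
Proof.
elim: n => [|n [k /andP[le lt]]].
  by exists 0%N; rewrite c0 /= -{1}c0 (cut_lt zc).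
case: (ltnP n.+1 (c k.+1)) => [lt'|ge]; first by exists k; rewrite leqW.
by exists k.+1; rewrite ge /= (leq_ltn_trans lt) // (cut_lt zc).
Qed.

(** A finite approximation of the second factorization; the condition weakens as [N] decreases, as
    [uniform_bound] requires. *)
Fixpoint avoiding_chain (N i : nat) : Prop :=
  (forall j, i <> c j) /\
  (if N is N'.+1 then
     exists b, window w i (size (phi b)) = phi b /\
               avoiding_chain N' (i + size (phi b))
   else True).

Lemma avoiding_chainW N i : avoiding_chain N.+1 i -> avoiding_chain N i.
Proof.
elim: N i => [|N IH] i; first by case.
case=> av [b [wb ch]]; split=> //; exists b; split=> //; exact: IH.
Qed.

(** The blocks lying in the recurrence at [n] of a prefix are moved back by [n]; a cut [c j] met
    there would give [n + c j = c k]. *)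
Lemma translated_chain n L N k :
  window w n L = window w 0 L ->
  (forall i j, (c i <= L)%N -> (n + c i)%N <> c j) ->
  (n <= c k)%N -> (c (k + N) <= n + L)%N -> avoiding_chain N (c k - n).
Proof.
move=> eL av; elim: N k => [|N IH] k nk kL.
  split=> // j E; apply: (av j k); last by lia.
  by move: kL; rewrite addn0; lia.
have le : (c k <= c k.+1)%N by exact: cut_le zc _ _ _.
have le' : (c k.+1 <= c (k + N.+1))%N.
  by rewrite addnS (cut_le zc) // ltnS leq_addr.
split; first by move=> j E; apply: (av j k); lia.
have [e1 e2] := zc k; exists (z k); split.
  by rewrite -(window_shift eL) ?subnKC //; lia.
by rewrite addnBAC // -e1; apply: IH; rewrite ?addSnnS //; lia.
Qed.

(** This is König's lemma: a cut lies within [M] after [n], so one start carries chains of every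
    length, and finiteness of the alphabet lets such a start be prolonged by a block. *)
Lemma second_factorization :
  (forall L, exists n, window w n L = window w 0 L /\
     forall i j, (c i <= L)%N -> (n + c i)%N <> c j) ->
  exists z' c', factorization phi w z' c' /\ forall i j, c' i <> c j.
Proof.
move=> H; pose M := (\max_b size (phi b)).
have cM k : (c k.+1 <= c k + M)%N.
  rewrite (zc k).1 leq_add2l.
  exact: (leq_bigmax (F := fun b => size (phi b))).
have cMD k N : (c (k + N) <= c k + N * M)%N.
  elim: N => [|N IH]; first by rewrite addn0 mul0n addn0.
  by rewrite addnS mulSn; have := cM (k + N)%N; lia.
have [|N|i0 alive0] := @uniform_bound 'I_M.+1 (fun N i => avoiding_chain N i).
- by move=> N i; exact: avoiding_chainW.
- have [n [eL av]] := H (N.+1 * M)%N.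
  have [k nk kM] : exists2 k, (n <= c k)%N & (c k <= n + M)%N.
    case: (posnP n) => [->|n0]; first by exists 0%N; rewrite c0.
    have [k /andP[lo hi]] := between_cuts n.-1.
    by exists k.+1; have := cM k; lia.
  have lt : (c k - n < M.+1)%N by lia.
  exists (Ordinal lt); apply: translated_chain eL av nk _.
  by apply: leq_trans (cMD _ _) _; rewrite mulSn; lia.
pose alive i := forall N, avoiding_chain N i.
have next i : exists b, alive i ->
    window w i (size (phi b)) = phi b /\ alive (i + size (phi b))%N.
  (* The letter [z 0] is a mere default, making the choice total. *)
  case: (pselect (alive i)) => [al|nal]; last by exists (z 0%N).
  have [|N|b Hb] := @uniform_bound _ (fun N b =>
      window w i (size (phi b)) = phi b /\
      avoiding_chain N (i + size (phi b))).
  - by move=> N b [wb ch]; split=> //; exact: avoiding_chainW.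
  - by have [_] := al N.+1.
  by exists b => _; split=> [|N]; [have [] := Hb 0%N | have [] := Hb N].
have [f Hf] := choice next.
pose c' n := iter n (fun i => i + size (phi (f i)))%N (i0 : nat).
have al n : alive (c' n) by elim: n => //= n IH; have [] := Hf _ IH.
exists (fun n => f (c' n)), c'; split=> [n|i j].
  by split=> //; have [] := Hf _ (al n).
by have [] := al i 0%N.
Qed.

End SecondFactorization.

(** * Consequences of WELLDOC *)

Section Welldoc.
Variables (sigma : nat) (w : nat -> 'I_sigma).
Hypothesis wd : WELLDOC w.

Lemma welldoc_count m L (t : 'I_sigma -> nat) :
  exists n, window w n L = window w 0 L /\
    forall j, count_mem j (window w 0 n) = t j %[mod m.+1].
Proof.
have fac : factor w (window w 0 L).
  by exists 0%N; rewrite /occurs_at size_window.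
have : Xmod w (window w 0 L) m (\row_j inZp (t j)) by rewrite (wd m fac).
case=> v [n occ <-] /rowP E; exists n; split.
  by move: occ; rewrite /occurs_at /= /occurs_at size_window.
by move=> j; have := E j; rewrite !mxE => /(congr1 val).
Qed.

(** The Parikh vector is prescribed to be [k] times the unit vector at [j]. *)
Lemma welldoc_sum m L (r : 'I_sigma -> int) j k :
  exists n, window w n L = window w 0 L /\
    (m.+1%:Z %| \sum_(x <- window w 0 n) r x - r j * k%:Z)%Z.
Proof.
have [n [eL cnt]] := welldoc_count m L (fun i => if i == j then k else 0%N).
exists n; split=> //.
rewrite sum_count_enum.
have -> : r j * k%:Z = \sum_i (if i == j then k else 0%N)%:Z * r i.
  rewrite (bigD1 j) //= eqxx mulrC big1 ?addr0 //.
  by move=> i /negbTE ->; rewrite mul0r.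
rewrite -sumrB; elim/big_rec: _ => [|i x _ IH]; first exact: dvdz0.
rewrite rpredD // -mulrBl dvdz_mulr // -eqz_mod_dvd !modz_nat.
by rewrite (cnt i).
Qed.

(** Some prefix has sum congruent to [r j * B.+1] modulo twice its absolute value. This sum is a
    multiple of [B.+1], so the bound makes it zero, against the factor two. *)
Lemma welldoc_unbounded (r : 'I_sigma -> int) j (B : nat) : r j != 0 ->
  ~ forall n, (`|(\sum_(x <- window w 0 n) r x)%R| <= B)%N.
Proof.
move=> rj bnd; have rj0 : (0 < `|r j|)%N by rewrite absz_gt0.
have m0 : (0 < (B.+1 * `|r j|).*2)%N by rewrite double_gt0 muln_gt0.
have [n [_]] := welldoc_sum (B.+1 * `|r j|).*2.-1 0 r j B.+1.
rewrite prednK // => dv; have := bnd n; set s := \sum_(_ <- _) _ in dv *.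
have dB : (B.+1%:Z %| s)%Z.
  rewrite -[s](subrK (r j * B.+1%:Z)) rpredD ?dvdz_mull //.
  by apply: dvdz_trans dv; rewrite dvdzE !absz_nat -muln2 -mulnA dvdn_mulr.
have [s0|s0 le] := eqVneq s 0.
  move: dv; rewrite s0 sub0r dvdzE abszN abszM /= mulnC => /dvdn_leq.
  by rewrite muln_gt0 rj0 => /(_ isT); lia.
rewrite dvdzE in dB.
by have := dvdn_leq _ dB; rewrite absz_gt0 s0 => /(_ isT) /=; lia.
Qed.

Lemma exists_orthogonal (u : seq 'I_sigma) : (2 <= sigma)%N ->
  exists (r : 'I_sigma -> int) j, r j != 0 /\ \sum_(x <- u) r x = 0.
Proof.
move=> s2; pose i0 := Ordinal (ltnW s2); pose i1 := Ordinal s2.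
have [c0|c0] := eqVneq (count_mem i0 u) 0%N.
  by exists (fun x => (x == i0)%:Z), i0; rewrite sum_eq_count c0 eqxx.
exists (fun x => (count_mem i1 u)%:Z * (x == i0)%:Z
                 - (count_mem i0 u)%:Z * (x == i1)%:Z), i1; split.
  by rewrite eqxx mulr0 sub0r mulr1 oppr_eq0.
by rewrite sumrB -!mulr_sumr !sum_eq_count mulrC subrr.
Qed.

(** A functional vanishing on one period has eventually periodic, hence bounded, prefix sums. *)
Lemma welldoc_aperiodic N D : (2 <= sigma)%N -> (0 < D)%N ->
  ~ forall n, (N <= n)%N -> w (n + D)%N = w n.
Proof.
move=> s2 D0 per.
have [r [j [rj r0]]] := exists_orthogonal (window w N D) s2.
have period0 k : \sum_(x <- window w (N + k) D) r x = 0.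
  elim: k => [|k IH]; first by rewrite addn0.
  have e1 := windowD w (N + k) 1 D; have e2 := windowD w (N + k) D 1.
  move: e1; rewrite (addnC 1%N) e2 !window1 per ?leq_addr // addn1 -addnS.
  move=> /(congr1 (fun u => \sum_(x <- u) r x)).
  by rewrite !big_cat /= !big_seq1 IH add0r -[LHS]addr0 => /addrI.
pose f n := \sum_(x <- window w 0 n) r x.
apply: (@welldoc_unbounded r j (\sum_(i < N + D) `|f i|) rj).
elim/ltn_ind => n IH; case: (ltnP n (N + D)) => [lt|ge].
  by rewrite (bigD1 (Ordinal lt)) //= leq_addr.
rewrite -(subnK (leq_trans (leq_addl N D) ge)) windowD big_cat add0n /=.
rewrite -(subnKC (_ : N <= n - D)%N); last by lia.
by rewrite period0 addr0; apply: IH; lia.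
Qed.

End Welldoc.

(** * The canonical factorization of a fixed point *)

(** For large [n] the prefix begins the [n]-th iterate, so its image begins the next iterate, as
    does a prefix of [w] of the same length. *)
Lemma generated_fixed sigma (phi : 'I_sigma -> seq 'I_sigma) w k :
  generated_by phi w ->
  morph phi (window w 0 k) = window w 0 (size (morph phi (window w 0 k))).
Proof.
case=> a [s [_ _ lim]]; set u := morph phi _.
have [N1 H1] := lim k; have [N2 H2] := lim (size u).
have /prefixP [t1 E1] := H1 _ (leq_maxl N1 N2).
have /prefixP [t2 E2] := H2 _ (leqW (leq_maxr N1 N2)).
move: E2; rewrite iterS E1 morph_cat => /(congr1 (take (size u))).
by rewrite -/u !take_size_cat ?size_window.
Qed.

Section Generated.
Variables (sigma : nat) (phi : 'I_sigma -> seq 'I_sigma) (w : nat -> 'I_sigma).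
Hypothesis hw : generated_by phi w.

Definition canonical_cut k := size (morph phi (window w 0 k)).

Lemma canonical_factorization : factorization phi w w canonical_cut.
Proof.
have cS n : canonical_cut n.+1 = (canonical_cut n + size (phi (w n)))%N.
  rewrite /canonical_cut -[n.+1]addn1 windowD window1 morph_cat size_cat.
  by rewrite morph1.
move=> n; split=> //; have := generated_fixed n.+1 hw.
rewrite -/(canonical_cut _) cS windowD -[n.+1]addn1 windowD window1 morph_cat.
rewrite (generated_fixed n hw) morph1 => /eqP.
by rewrite eqseq_cat // eqxx => /eqP.
Qed.

Lemma sum_canonical_cut (r : 'rV[int]_sigma) k :
  \sum_(x <- window w 0 (canonical_cut k)) r 0 x =
  \sum_(i <- window w 0 k) (r *m incidence_mx phi) 0 i.
Proof.
rewrite -(generated_fixed k hw) sum_flatten_map.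
by apply: eq_bigr => i _; rewrite mul_incidence_mxE.
Qed.

(** A kernel row has sum zero up to each cut, so only the unfinished last block contributes. *)
Lemma welldoc_det_neq0 : nonerasing phi -> WELLDOC w ->
  \det (incidence_mx phi) <> 0.
Proof.
move=> ne wd /eqP/det0P [r r0 rA].
have [j rj] : exists j, r 0 j != 0 by apply/rV0Pn.
pose B := (\sum_b \sum_(x <- phi b) `|r 0%R x|)%N.
apply: (@welldoc_unbounded _ _ wd (r 0) j B rj) => n.
have zc := canonical_factorization.
have [k /andP[lo hi]] := between_cuts ne zc erefl n.
rewrite -(subnKC lo) windowD big_cat /= sum_canonical_cut rA.
rewrite big1 ?add0r; last first.
  by move=> i _; rewrite mxE.
have -> : window w (0 + canonical_cut k) (n - canonical_cut k) =
    take (n - canonical_cut k) (phi (w k)).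
  rewrite -(zc k).2 take_window (minn_idPl _) //.
  by rewrite (zc k).1 in hi; lia.
apply: (@leq_trans (\sum_(x <- phi (w k)) `|r 0%R x|)%N); last first.
  by rewrite /B (bigD1 (w k)) //= leq_addr.
rewrite -[X in (_ <= \sum_(_ <- X) _)%N](cat_take_drop (n - canonical_cut k)).
rewrite big_cat /=; apply: leq_trans (leq_addr _ _).
elim: (take _ _) => [|x u IH]; first by rewrite !big_nil.
by rewrite !big_cons; lia.
Qed.

End Generated.

(** * The adjugate and the conclusion *)

(** Otherwise [\adj A] divided by [\det A] is an integral inverse of [A], and [\det A] is a unit. *)
Lemma adjugate_not_divisible n (A : 'M[int]_n) :
  \det A <> 0 -> \det A <> 1 -> \det A <> -1 ->
  exists i j, ~~ (\det A %| (\adj A) i j)%Z.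
Proof.
move=> d0 d1 dN1; apply: contrapT => none.
have dv i j : (\det A %| (\adj A) i j)%Z.
  by apply/negPn/negP => nd; apply: none; exists i, j.
pose B : 'M[int]_n := \matrix_(i, j) ((\adj A) i j %/ \det A)%Z.
have adjE : \adj A = \det A *: B.
  by apply/matrixP => i j; rewrite [RHS]mxE [X in _ * X]mxE mulrC divzK ?dv.
have BA : B *m A = 1%:M.
  apply/matrixP => i j; apply: (mulfI (introN eqP d0)).
  have := congr1 (fun M : 'M_n => M i j) (mul_adj_mx A).
  by rewrite adjE -scalemxAl !mxE mulr_natr.
have := congr1 (fun M => absz (\det M)) BA.
rewrite det_mulmx det1 abszM => /eqP; rewrite muln_eq1 => /andP[_ /eqP e].
by case: (\det A) e d1 dN1 => [[|[|]]|[|]].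
Qed.

Theorem theorem9 (sigma : nat) (hsigma : (2 <= sigma)%N)
  (phi : 'I_sigma -> seq 'I_sigma) (hphi : nonerasing phi)
  (w : nat -> 'I_sigma) (hw : generated_by phi w)
  (hdet1 : \det (incidence_mx phi) <> 1)
  (hdetN1 : \det (incidence_mx phi) <> -1) :
  ~ WELLDOC w.
Proof.
move=> wd; have det0 := welldoc_det_neq0 hw hphi wd.
set A := incidence_mx phi in hdet1 hdetN1 det0.
have [i [j ndvd]] := adjugate_not_divisible det0 hdet1 hdetN1.
pose r := row i (\adj A).
have zc := canonical_factorization hw; set c := canonical_cut phi w in zc.
pose f n := \sum_(x <- window w 0 n) r 0 x.
(* Here [r *m A] is [\det A] times a unit row. *)
have cut_dvd k : (\det A %| f (c k))%Z.
  rewrite /f sum_canonical_cut // -row_mul mul_adj_mx.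
  elim/big_rec: _ => [|x s _ IH]; first exact: dvdz0.
  by rewrite rpredD // !mxE; case: eqP => _; rewrite ?mulr1n ?mulr0n ?dvdz0.
have [L|z' [c' [zc' dis]]] := second_factorization hphi zc erefl.
  (* Prescribing the Parikh vector of the single letter [j] makes [f n] congruent to the chosen
     adjugate entry; a common cut would make [f n] a difference of values at cuts, hence
     divisible. *)
  have [n [eL dv]] := welldoc_sum wd `|\det A|.-1 L (r 0) j 1.
  exists n; split=> // a b leL E; move/negP: ndvd; apply.
  have fn : (\det A %| f n)%Z.
    have -> : f n = f (c b) - f (c a).
      rewrite -E /f windowD big_cat add0n /=.
      have := window_shift eL (leL : 0 + _ <= _)%N; rewrite addn0 => ->.
      by rewrite addrK.
    by rewrite rpredB.
  have -> : (\adj A) i j = f n - (f n - r 0 j * 1%:Z).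
    by rewrite mulr1 subKr [r 0 j]mxE.
  rewrite rpredB //; move: dv; rewrite prednK ?absz_gt0; last exact/eqP.
  by rewrite dvdzE absz_nat -dvdzE.
have [N [D [D0 per]]] := periodic_or_singular hphi zc' zc dis det0.
exact: (@welldoc_aperiodic _ _ wd N D hsigma D0 per).
Qed.
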